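(* Let $(X,\|\cdot\|)$ be a real normed space with $\dim X=2$, and fix a basis of $X$. There is a unique operator $\hat T\in \mathbf{PD}(X,\mathbb{R}^2)$ such that $\hat T(B_X)\supset B_{\mathbb{R}^2}$ and $$\|\hat T\| = d_2(X).$$ This operator is characterised by the following property; that is, for $T\in \mathbf{PD}(X,\mathbb{R}^2)$ with $T(B_X)\supset B_{\mathbb{R}^2}$, one has $\|T\|=d_2(X)$ if and only if: there are $x_1,x_2\in S_X$ with $x_1\neq\pm x_2$, and $y_1,y_2\in S_X$ with $y_1\neq\pm y_2$, such that $$|Tx_i|=\|T\|,\quad i=1,2,$$ $$|Ty_i|=1,\quad i=1,2,$$ $$y_1\in\operatorname{cone}\{x_1,x_2\},\qquad y_2\in\operatorname{cone}\{-x_1,x_2\}.$$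
   Context: $\mathbb{R}^2$ carries the standard Euclidean norm $|\cdot|$. $B_X$ and $S_X$ denote the closed unit ball and the unit sphere of $X$; $B_{\mathbb{R}^2}$ is the closed Euclidean unit ball. For a linear operator $T:X\to\mathbb{R}^2$, $\|T\|=\max_{x\in S_X}|Tx|$ is the operator norm. The Banach-Mazur distance between isomorphic normed spaces is $d(X,Y)=\inf\{\|T\|\cdot\|T^{-1}\|:\ T:X\to Y \text{ isomorphism}\}$, and $d_2(X):=d(X,\mathbb{R}^2)$. $\mathbf{PD}(X,\mathbb{R}^2)$ denotes the set of linear operators $T:X\to\mathbb{R}^2$ whose matrix with respect to the fixed basis of $X$ and the standard basis of $\mathbb{R}^2$ is symmetric and positive definite. $\operatorname{cone}\{x,y\}:=\{\alpha x+\beta y:\ \alpha,\beta\ge 0\}$. *)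

(* Defs.v *)
From HB Require Import structures.
From mathcomp Require Import all_boot all_order all_algebra.
From mathcomp Require Import all_classical all_reals all_analysis.
From mathcomp Require Import ring lra.

Set Implicit Arguments.
Unset Strict Implicit.
Unset Printing Implicit Defensive.

Import Order.TTheory GRing.Theory Num.Theory.
Import numFieldNormedType.Exports.

Local Open Scope classical_set_scope.
Local Open Scope ring_scope.

(* An alias of 'cV[R]_2: the library's own norm on matrices is the sup norm,
   so the Euclidean norm has to live on a separate type. *)
Definition euclidean2 (R : realType) : Type := 'cV[R]_2.

HB.instance Definition _ (R : realType) :=
  GRing.Lmodule.on (euclidean2 R).

Section EuclideanNorm.
Variable R : realType.

Definition euclidean_norm (x : euclidean2 R) : R :=
  Num.sqrt (\sum_(i < 2) (x : 'cV[R]_2) i 0 ^+ 2).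

Lemma ler_euclidean_normD (x y : euclidean2 R) :
  euclidean_norm (x + y) <= euclidean_norm x + euclidean_norm y.
Proof.
rewrite /euclidean_norm !big_ord_recl !big_ord0 !addr0 !mxE.
set a := _ x _ _; set b := _ x _ _; set c := _ y _ _; set d := _ y _ _.
have s0 (u v : R) : 0 <= u ^+ 2 + v ^+ 2 by rewrite addr_ge0 ?sqr_ge0.
set p := Num.sqrt (a ^+ 2 + _); set q := Num.sqrt (c ^+ 2 + _).
have p0 : 0 <= p by exact: sqrtr_ge0.
have q0 : 0 <= q by exact: sqrtr_ge0.
rewrite -(ger0_norm (addr_ge0 p0 q0)) -sqrtr_sqr ler_sqrt ?sqr_ge0//.
have pE : p ^+ 2 = a ^+ 2 + b ^+ 2 by rewrite sqr_sqrtr.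
have qE : q ^+ 2 = c ^+ 2 + d ^+ 2 by rewrite sqr_sqrtr.
suff : a * c + b * d <= p * q by lra.
apply: (le_trans (ler_norm _)).
rewrite -sqrtr_sqr -sqrtrM// ler_sqrt ?mulr_ge0//.
have := sqr_ge0 (a * d - b * c); nra.
Qed.

Lemma euclidean_normZ (l : R) (x : euclidean2 R) :
  euclidean_norm (l *: x) = `|l| * euclidean_norm x.
Proof.
rewrite /euclidean_norm -sqrtr_sqr -sqrtrM ?sqr_ge0// mulr_sumr.
by congr Num.sqrt; apply: eq_bigr => i _; rewrite mxE exprMn.
Qed.

Lemma euclidean_norm0_eq0 (x : euclidean2 R) : euclidean_norm x = 0 -> x = 0.
Proof.
move=> /eqP; rewrite sqrtr_eq0 => le0; apply/matrixP => i j.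
have /eqP : \sum_(i < 2) (x : 'cV[R]_2) i 0 ^+ 2 = 0.
  by apply/eqP; rewrite eq_le le0 sumr_ge0// => k _; exact: sqr_ge0.
rewrite psumr_eq0 => [/allP/(_ i (mem_index_enum _))|k _]; last exact: sqr_ge0.
by rewrite sqrf_eq0 => /eqP xi; rewrite (ord1 j) xi mxE.
Qed.

HB.instance Definition _ := @Lmodule_isNormed.Build R (euclidean2 R)
  euclidean_norm ler_euclidean_normD euclidean_normZ euclidean_norm0_eq0.

End EuclideanNorm.

Definition unit_ball (R : realType) (X : normedModType R) : set X :=
  [set x | `|x| <= 1].

Definition unit_sphere (R : realType) (X : normedModType R) : set X :=
  [set x | `|x| = 1].

Arguments unit_ball {R} X.
Arguments unit_sphere {R} X.

Definition opnorm (R : realType) (X Y : normedModType R) (T : {linear X -> Y}) : R :=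
  sup [set `|T x| | x in unit_sphere X].

(* [sup] is 0 on unbounded sets, so both directions are required to be
   continuous; this is automatic in finite dimension. *)
Definition is_isomorphism (R : realType) (X Y : normedModType R)
    (T : {linear X -> Y}) (S : {linear Y -> X}) : Prop :=
  [/\ cancel T S, cancel S T, continuous T & continuous S].

Definition banach_mazur (R : realType) (X Y : normedModType R) : R :=
  inf [set r | exists (T : {linear X -> Y}) (S : {linear Y -> X}),
         is_isomorphism T S /\ r = opnorm T * opnorm S].

Definition d2 (R : realType) (X : normedModType R) : R :=
  banach_mazur X (euclidean2 R).

Definition is_basis (R : realType) (X : normedModType R) (n : nat)
    (e : 'I_n -> X) : Prop :=
  (forall c : 'I_n -> R, \sum_(i < n) c i *: e i = 0 -> forall i, c i = 0) /\
  (forall x : X, exists c : 'I_n -> R, x = \sum_(i < n) c i *: e i).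

Definition matrix_in (R : realType) (X : normedModType R) (e : 'I_2 -> X)
    (T : {linear X -> euclidean2 R}) : 'M[R]_2 :=
  \matrix_(i, j) (T (e j) : 'cV[R]_2) i 0.

Definition posdefmx (R : realType) (n : nat) (A : 'M[R]_n) : Prop :=
  forall v : 'cV[R]_n, v != 0 -> 0 < (v^T *m A *m v) 0 0.

Definition PD (R : realType) (X : normedModType R) (e : 'I_2 -> X) :
    set {linear X -> euclidean2 R} :=
  [set T | (matrix_in e T)^T = matrix_in e T /\ posdefmx (matrix_in e T)].

Definition cone (R : realType) (X : normedModType R) (x y : X) : set X :=
  [set z | exists a b : R, [/\ 0 <= a, 0 <= b & z = a *: x + b *: y]].

(* Main.v *)
Require Import Defs.
From HB Require Import structures.
From mathcomp Require Import all_boot all_order all_algebra.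
From mathcomp Require Import all_classical all_reals all_analysis.
From mathcomp Require Import ring lra.

Set Implicit Arguments.
Unset Strict Implicit.
Unset Printing Implicit Defensive.

Import Order.TTheory GRing.Theory Num.Theory.
Import numFieldNormedType.Exports.

Local Open Scope classical_set_scope.
Local Open Scope ring_scope.

(** Fix coordinates by the basis.  An operator [T] gives the quadratic form
    [q v = |T v|^2] on the plane; with [N] the norm of [X] in coordinates, the
    inclusion of the Euclidean ball in [T(B_X)] says [N^2 <= q], and
    [|T| <= K] says [q <= K^2 * N^2].  So minimising the distortion is to find
    a form [q] and the least [M] with [N^2 <= q <= M * N^2] ([sandwich],
    [optimal]).  Every positive definite form has exactly one symmetric positive
    definite square root ([PD_with_form], [PD_map_form_inj]), hence the theorem
    is one about forms: the least [M] is [d2 X ^ 2] ([optimal_d2]), since an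
    isomorphism with inverse [S], rescaled by the norm of [S], yields a
    sandwiched form.

    An optimal pair exists by compactness ([optimal_exists]).  For its
    characterisation, call a direction outer when [q = M * N^2] and inner when
    [q = N^2].  If a form [d] is positive on the inner and nonpositive on the
    outer directions, then moving [q] a little along [d] (corrected by a
    multiple of [q]) makes both inequalities strict, and [M] can be lowered;
    so for an optimal pair no such [d] exists ([optimal_not_separated]).  On the
    projective line a form of signature (1,1) changes sign at two points which
    can be prescribed.  Take an inner direction as the point at infinity, and
    the form whose zeros are the two extreme outer directions: it is
    nonpositive on the outer directions, so some further inner direction lies
    between these two.  That is the interlacing outer, inner, outer, inner of
    the cone conditions ([optimal_interlaced]).

    Conversely, let [d] be the difference between another sandwiched form, with
    bound at most [M], and an interlaced [q].  It is nonpositive at [x1], [x2]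
    and nonnegative at [y1], [y2].  Expanding [d] at [y1 = a x1 + b x2] bounds
    the polar form of [d] at [(x1, x2)] from below by 0, and expanding at
    [y2 = - a' x1 + b' x2] bounds it from above by 0; a smaller bound would make
    these strict, hence contradictory ([interlaced_le]), and an equal bound
    forces [d = 0] ([interlaced_unique]). *)

(** * Perturbation on the Euclidean circle *)

Section Circle.
Variable R : realType.
Implicit Types (u v : R * R) (g h : R * R -> R).

Definition circle : set (R * R) := [set v | v.1 ^+ 2 + v.2 ^+ 2 = 1].

Definition scale2 (k : R) v : R * R := (k * v.1, k * v.2).

Lemma continuous_fst : continuous (fun v : R * R => v.1).
Proof. by move=> v; apply: cvg_fst. Qed.

Lemma continuous_snd : continuous (fun v : R * R => v.2).
Proof. by move=> v; apply: cvg_snd. Qed.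

Lemma circle_compact : compact circle.
Proof.
apply: (@subclosed_compact _ _ (`[- 1 : R, 1] `*` `[- 1 : R, 1])).
- apply: (@preimage_closed _ _ (fun v : R * R => v.1 ^+ 2 + v.2 ^+ 2) [set 1]).
    move=> v _; apply: cvgD; rewrite /expr2.
      by apply: cvgM; apply: continuous_fst.
    by apply: cvgM; apply: continuous_snd.
  exact: closed_eq.
- by apply: compact_setX; exact: segment_compact.
- move=> [a b]; rewrite /circle /= => ab1.
  by split => /=; rewrite in_itv /=; apply/andP; split; nra.
Qed.

Lemma circle_nonempty : circle !=set0.
Proof. by exists (1, 0); rewrite /circle /=; ring. Qed.

Lemma circle_neq0 u : circle u -> u <> (0, 0).
Proof. by rewrite /circle => + u0; rewrite u0 /=; lra. Qed.

Lemma circle_polar v : v <> (0, 0) ->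
  exists r u, [/\ 0 < r, circle u & v = scale2 r u].
Proof.
case: v => a b ab0.
have s0 : 0 < a ^+ 2 + b ^+ 2.
  rewrite lt_neqAle addr_ge0 ?sqr_ge0// andbT eq_sym.
  apply/eqP => /eqP; rewrite paddr_eq0 ?sqr_ge0// !sqrf_eq0.
  by move=> /andP[/eqP a0 /eqP b0]; apply: ab0; rewrite a0 b0.
set r := Num.sqrt (a ^+ 2 + b ^+ 2).
have r0 : 0 < r by rewrite sqrtr_gt0.
have rE : r ^+ 2 = a ^+ 2 + b ^+ 2 by rewrite sqr_sqrtr// ltW.
exists r, (a / r, b / r); split => //.
  rewrite /circle /= !exprMn -mulrDl -rE exprVn divff//.
  by rewrite expf_neq0// gt_eqF.
by rewrite /scale2 /=; congr (_, _); field; rewrite gt_eqF.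
Qed.

(** [max g h] is positive on the compact circle, hence bounded below there by
    some [mm > 0].  Where [h >= mm] nothing can go wrong; elsewhere [g >= mm]
    absorbs a small multiple of the bounded function [h]. *)
Lemma circle_perturb g h : continuous g -> continuous h ->
  (forall v, circle v -> 0 <= g v) ->
  (forall v, circle v -> g v = 0 -> 0 < h v) ->
  exists2 E, 0 < E &
    forall e, 0 < e <= E -> forall v, circle v -> 0 < g v + e * h v.
Proof.
move=> cg ch g0 gh0.
have [m /set_mem mc mP] := compact_EVT_min circle_nonempty circle_compact
  (continuous_subspaceT (fun v => continuous_max (cg v) (ch v))).
have [k /set_mem kc kP] := compact_EVT_min circle_nonempty circle_compact
  (continuous_subspaceT ch).
rewrite /= in mP kP.
have m0 : 0 < Num.max (g m) (h m).
  rewrite lt_max; have [//|gm] := ltP 0 (g m); rewrite gh0//.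
  by apply/eqP; rewrite eq_le gm g0.
set mm := Num.max _ _ in m0 mP.
have K0 : 0 < `|h k| + 1 by rewrite ltr_wpDl.
exists (mm / (`|h k| + 1) / 2); first by rewrite !divr_gt0.
move=> e /andP[e0 eE] v vc.
have := mP v (mem_set vc); rewrite le_max => /orP[gm|hm]; last first.
  by rewrite ltr_wpDl ?g0// mulr_gt0// (lt_le_trans m0).
have hk : - (`|h k| + 1) < h v.
  apply: lt_le_trans (kP v (mem_set vc)).
  by have := lerNnormlW (lexx `|h k|); lra.
have : e * (`|h k| + 1) <= mm / 2.
  by rewrite -ler_pdivlMr// mulrAC.
nra.
Qed.

End Circle.

(** * Quadratic forms squeezed by a gauge *)

Section Forms.
Variable R : realType.
Implicit Types (u v : R * R) (c d : R * R * R).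

(** The coefficients [(a, b, c)] stand for the symmetric matrix with diagonal
    [a], [c] and off-diagonal entry [b]. *)
Definition qform c v : R :=
  c.1.1 * v.1 ^+ 2 + 2 * c.1.2 * (v.1 * v.2) + c.2 * v.2 ^+ 2.

Definition lin_comb (k : R) c (l : R) d : R * R * R :=
  (k * c.1.1 + l * d.1.1, k * c.1.2 + l * d.1.2, k * c.2 + l * d.2).

Lemma qform_lin_comb k c l d v :
  qform (lin_comb k c l d) v = k * qform c v + l * qform d v.
Proof. rewrite /qform /lin_comb /=; ring. Qed.

Lemma qform_scale c k v : qform c (scale2 k v) = k ^+ 2 * qform c v.
Proof. rewrite /qform /scale2 /=; ring. Qed.

Lemma qform_continuous c : continuous (qform c).
Proof.
have c1 := @continuous_fst R; have c2 := @continuous_snd R.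
move=> v; rewrite /qform /expr2; apply: cvgD; first apply: cvgD.
- by apply: cvgM; [exact: cvg_cst|apply: cvgM; [exact: c1|exact: c1]].
- by apply: cvgM; [exact: cvg_cst|apply: cvgM; [exact: c1|exact: c2]].
- by apply: cvgM; [exact: cvg_cst|apply: cvgM; [exact: c2|exact: c2]].
Qed.

Lemma qform_continuousl v : continuous (qform ^~ v).
Proof.
move=> [[a b] c]; rewrite /qform; apply: cvgD; first apply: cvgD.
- apply: cvgM; last exact: cvg_cst.
  by apply: (cvg_comp fst fst); [exact: cvg_fst|exact: cvg_fst].
- apply: cvgM; last exact: cvg_cst; apply: cvgM; first exact: cvg_cst.
  by apply: (cvg_comp fst snd); [exact: cvg_fst|exact: cvg_snd].
- by apply: cvgM; [exact: cvg_snd|exact: cvg_cst].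
Qed.

(** The gauge of a compact symmetric star-shaped neighbourhood of the origin. *)
Record gauge (N : R * R -> R) : Prop := Gauge {
  gauge_continuous : continuous N;
  gauge_scale : forall k v, N (scale2 k v) = `|k| * N v;
  gauge_gt0 : forall v, v <> (0, 0) -> 0 < N v }.

Definition sandwich (N : R * R -> R) c (M : R) : Prop :=
  forall v, N v ^+ 2 <= qform c v <= M * N v ^+ 2.

Definition optimal N c M : Prop :=
  sandwich N c M /\ forall c' M', sandwich N c' M' -> M <= M'.

Section Gauge.
Variable N : R * R -> R.
Hypothesis gN : gauge N.

Lemma gauge0 : N (0, 0) = 0.
Proof.
have := gauge_scale gN 0 (0, 0).
by rewrite /scale2 /= !mul0r normr0 mul0r.
Qed.

Lemma gauge_sqr_scale k v : N (scale2 k v) ^+ 2 = k ^+ 2 * N v ^+ 2.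
Proof. by rewrite (gauge_scale gN) exprMn real_normK// num_real. Qed.

Lemma gauge_sqr_gt0 v : v <> (0, 0) -> 0 < N v ^+ 2.
Proof. by move=> v0; rewrite exprn_gt0// (gauge_gt0 gN). Qed.

Lemma gauge_sqr_continuous : continuous (fun v => N v ^+ 2).
Proof. by move=> v; rewrite /expr2; apply: cvgM; exact: (gauge_continuous gN). Qed.

Lemma sandwich_on_circle c M :
  (forall v, circle v -> N v ^+ 2 <= qform c v <= M * N v ^+ 2) ->
  sandwich N c M.
Proof.
move=> H v; have [->|/circle_polar[r [u [r0 uc ->]]]] := pselect (v = (0, 0)).
  by rewrite gauge0 /qform /=; apply/andP; split; nra.
rewrite qform_scale gauge_sqr_scale [M * _]mulrCA !ler_pM2l ?exprn_gt0//.
exact: H.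
Qed.

Lemma inner_gap_continuous c : continuous (fun v => qform c v - N v ^+ 2).
Proof.
by move=> v; apply: cvgB; [exact: qform_continuous|exact: gauge_sqr_continuous].
Qed.

Lemma outer_gap_continuous c M : continuous (fun v => M * N v ^+ 2 - qform c v).
Proof.
move=> v; apply: cvgB; last exact: qform_continuous.
by apply: cvgM; [exact: cvg_cst|exact: gauge_sqr_continuous].
Qed.

(** If [d] separated the inner from the outer contacts, both inequalities would
    become strict for [c + e * d] with [e] small, and then [M] could be
    decreased. *)
Lemma optimal_not_strictly_separated c M d : optimal N c M ->
  (forall v, circle v -> qform c v = N v ^+ 2 -> 0 < qform d v) ->
  (forall v, circle v -> qform c v = M * N v ^+ 2 -> qform d v < 0) ->
  False.
Proof.
move=> [sw opt] dpos dneg.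
have [e1 e10 P1] : exists2 E, 0 < E & forall e, 0 < e <= E -> forall v,
    circle v -> 0 < qform c v - N v ^+ 2 + e * qform d v.
  apply: circle_perturb => [||v _|v vc /subr0_eq]; last exact: dpos.
  - exact: inner_gap_continuous.
  - exact: qform_continuous.
  - by have /andP[] := sw v; lra.
have [e2 e20 P2] : exists2 E, 0 < E & forall e, 0 < e <= E -> forall v,
    circle v ->
    0 < M * N v ^+ 2 - qform c v + e * qform (lin_comb (-1) d 0 d) v.
  apply: circle_perturb => [||v _|v vc /subr0_eq/esym/(dneg v vc)].
  - exact: outer_gap_continuous.
  - exact: qform_continuous.
  - by have /andP[] := sw v; lra.
  - by rewrite qform_lin_comb; lra.
set e := Num.min e1 e2.
have e0 : 0 < e by rewrite lt_min e10.
set c' := lin_comb 1 c e d.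
have lo v : circle v -> N v ^+ 2 < qform c' v.
  move=> /(P1 e); rewrite e0 ge_min lexx => /(_ isT).
  by rewrite [qform c' v]qform_lin_comb; lra.
have hi v : circle v -> 0 < M * N v ^+ 2 - qform c' v.
  move=> /(P2 e); rewrite e0 ge_min lexx orbT => /(_ isT).
  by rewrite [qform c' v]qform_lin_comb qform_lin_comb; lra.
have [e3 e30 P3] : exists2 E, 0 < E & forall e, 0 < e <= E -> forall v,
    circle v -> 0 < M * N v ^+ 2 - qform c' v + e * (-1 * N v ^+ 2).
  apply: circle_perturb => [||v /hi/ltW//|v /hi + eq0]; last by rewrite eq0 ltxx.
  - exact: outer_gap_continuous.
  - by move=> v; apply: cvgM; [exact: cvg_cst|exact: gauge_sqr_continuous].
have : M <= M - e3.
  apply: (opt c'); apply: sandwich_on_circle => v vc.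
  have := lo v vc; have := P3 e3; rewrite e30 lexx => /(_ isT v vc).
  by move=> ? /ltW ->; lra.
lra.
Qed.

(** A form vanishing at some outer contacts becomes negative there after
    subtracting a small multiple of [qform c], and remains positive on the
    compact set of inner contacts. *)
Lemma optimal_not_separated c M d : optimal N c M ->
  (forall v, circle v -> qform c v = N v ^+ 2 -> 0 < qform d v) ->
  (forall v, circle v -> qform c v = M * N v ^+ 2 -> qform d v <= 0) ->
  False.
Proof.
move=> opt dpos dneg; have [sw _] := opt.
have [e1 e10 P1] : exists2 E, 0 < E & forall e, 0 < e <= E -> forall v,
    circle v -> 0 < qform c v - N v ^+ 2 + e * qform d v.
  apply: circle_perturb => [||v _|v vc /subr0_eq]; last exact: dpos.
  - exact: inner_gap_continuous.
  - exact: qform_continuous.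
  - by have /andP[] := sw v; lra.
have {}P1 : forall v, circle v -> 0 < qform c v - N v ^+ 2 + e1 * qform d v.
  by apply: P1; rewrite e10 lexx.
have [e2 e20 P2] : exists2 E, 0 < E & forall e, 0 < e <= E -> forall v,
    circle v -> 0 < qform c v - N v ^+ 2 + e1 * qform d v
                    + e * qform (lin_comb (-1) c 0 c) v.
  apply: circle_perturb => [||v /P1/ltW//|v /P1 + eq0]; last by rewrite eq0 ltxx.
  - move=> v; apply: cvgD; first exact: inner_gap_continuous.
    by apply: cvgM; [exact: cvg_cst|exact: qform_continuous].
  - exact: qform_continuous.
apply: (optimal_not_strictly_separated (d := lin_comb e1 d (- e2) c) opt) => v vc cv.
  have := P2 e2; rewrite e20 lexx => /(_ isT v vc).
  by rewrite !qform_lin_comb cv; lra.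
have c0 : 0 < qform c v.
  have /andP[+ _] := sw v; apply: lt_le_trans.
  exact/gauge_sqr_gt0/circle_neq0.
rewrite qform_lin_comb; have := mulr_gt0 e20 c0.
have := mulr_ge0_le0 (ltW e10) (dneg v vc cv); lra.
Qed.

End Gauge.
End Forms.

(** * Existence of an optimal form and interlacing of its contacts *)

Section Alternation.
Variable R : realType.
Implicit Types (u v : R * R) (c d : R * R * R).
Variable N : R * R -> R.
Hypothesis gN : gauge N.

Lemma qform_inj c d : (forall v, qform c v = qform d v) -> c = d.
Proof.
case: c d => [[c1 c2] c3] [[d1 d2] d3] H.
have := H (1, 0); have := H (0, 1); have := H (1, 1); rewrite /qform /= => *.
by congr (_, _, _); lra.
Qed.

Lemma sandwich_ge1 c M : sandwich N c M -> 1 <= M.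
Proof.
move=> /(_ (1, 0)) /andP[lo hi].
have /(gauge_sqr_gt0 gN) : (1, 0) <> (0, 0) :> R * R by case=> /eqP; rewrite oner_eq0.
by move=> N0; rewrite -(ler_pM2r N0) mul1r; exact: le_trans hi.
Qed.

Lemma feasible : exists cM : R * R * R * R, sandwich N cM.1 cM.2.
Proof.
have Nc := continuous_subspaceT (gauge_sqr_continuous gN).
have [l lc lP] := compact_EVT_min (circle_nonempty R) (@circle_compact R) (Nc _).
have [h hc hP] := compact_EVT_max (circle_nonempty R) (@circle_compact R) (Nc _).
move: lc => /set_mem/circle_neq0/(gauge_sqr_gt0 gN) l0.
exists ((N h ^+ 2, 0, N h ^+ 2), N h ^+ 2 / N l ^+ 2).
apply: sandwich_on_circle => //= v vc.
have -> : qform (N h ^+ 2, 0, N h ^+ 2) v = N h ^+ 2.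
  by move: vc; rewrite /qform /circle /= => vc; rewrite -[RHS]mulr1 -vc; ring.
rewrite hP/=; last exact/mem_set.
by rewrite mulrAC ler_pdivlMr// ler_wpM2l ?sqr_ge0// lP//; exact/mem_set.
Qed.

(** The bound of a given sandwiched form confines the competitors to a box: the
    values at the basis vectors bound the diagonal coefficients, and
    nonnegativity at [(1, 1)] and [(1, -1)] bounds the mixed one. *)
Lemma optimal_exists : exists c M, optimal N c M.
Proof.
have [[c0 M0] /= sw0] := feasible.
pose F v := [set cM : R * R * R * R |
  N v ^+ 2 <= qform cM.1 v] `&` [set cM : R * R * R * R |
  0 <= cM.2 * N v ^+ 2 - qform cM.1 v].
pose a := M0 * N (1, 0) ^+ 2; pose b := M0 * N (0, 1) ^+ 2.
pose B : set (R * R * R * R) :=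
  ((`[0, a] `*` `[- (a + b), a + b]) `*` `[0, b]) `*` `[0, M0].
have Fcl : closed (\bigcap_(v in [set: R * R]) F v).
  apply: closed_bigI => v _.
  have fc : continuous (fun cM : R * R * R * R => qform cM.1 v).
    move=> cM; apply: (cvg_comp fst (fun c => qform c v)); first exact: cvg_fst.
    exact: qform_continuousl.
  apply: closedI.
    apply: (@preimage_closed _ _ (fun cM : R * R * R * R => qform cM.1 v)
      [set x | N v ^+ 2 <= x]); first by move=> ? _; exact: fc.
    exact: closed_ge.
  apply: (@preimage_closed _ _ (fun cM : R * R * R * R =>
      cM.2 * N v ^+ 2 - qform cM.1 v) [set x | 0 <= x]); last exact: closed_ge.
  move=> cM _; apply: cvgB; last exact: fc.
  by apply: cvgM; [exact: cvg_snd|exact: cvg_cst].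
have Bc : compact B by do 3?apply: compact_setX; exact: segment_compact.
have BF cM : sandwich N cM.1 cM.2 -> cM.2 <= M0 -> B cM.
  case: cM => [[[c1 c2] c3] M] /= sw MM0.
  have M1 := sandwich_ge1 sw.
  have le0 v : M * N v ^+ 2 <= M0 * N v ^+ 2 by rewrite ler_wpM2r ?sqr_ge0.
  have fge0 v : 0 <= qform (c1, c2, c3) v.
    by have /andP[+ _] := sw v; apply: le_trans; exact: sqr_ge0.
  have /andP[_ /le_trans/(_ (le0 _))] := sw (1, 0).
  have /andP[_ /le_trans/(_ (le0 _))] := sw (0, 1).
  have := fge0 (1, 0); have := fge0 (0, 1).
  have := fge0 (1, 1); have := fge0 (1, -1).
  rewrite /B /qform /= -/a -/b !in_itv /= => *.
  by do !split => /=; apply/andP; split; lra.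
pose K := B `&` \bigcap_(v in [set: R * R]) F v.
have Kc : compact K by exact: compact_closedI.
have KP cM : sandwich N cM.1 cM.2 -> cM.2 <= M0 -> K cM.
  move=> sw MM0; split; first exact: BF.
  by move=> v _; have /andP[lo hi] := sw v; split=> //=; rewrite subr_ge0.
have sndc : continuous (fun cM : R * R * R * R => cM.2).
  by move=> cM; exact: cvg_snd.
have K0 : K !=set0 by exists (c0, M0); apply: KP.
have [[c M] /set_mem[_ cMF] cMP] := compact_EVT_min K0 Kc
  (continuous_subspaceT sndc).
have sw : sandwich N c M by move=> v; have [/= lo] := cMF v I; rewrite subr_ge0 => hi; exact/andP.
exists c, M; split=> // c' M' sw'.
have [M'M0|/ltW M0M'] := leP M' M0.
  by apply: (cMP (c', M')); apply/mem_set/KP.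
by apply: le_trans M0M'; apply: (cMP (c0, M0)); apply/mem_set/KP.
Qed.

Definition det2 u v := u.1 * v.2 - u.2 * v.1.

Lemma det2C u v : det2 u v = - det2 v u.
Proof. rewrite /det2; ring. Qed.

Definition comb2 (k : R) u (l : R) v : R * R :=
  (k * u.1 + l * v.1, k * u.2 + l * v.2).

(** The symmetric bilinear form polarising [qform c]. *)
Definition polar c u v : R :=
  c.1.1 * (u.1 * v.1) + c.1.2 * (u.1 * v.2 + u.2 * v.1) + c.2 * (u.2 * v.2).

Lemma qform_comb2 c k u l v :
  qform c (comb2 k u l v) =
  k ^+ 2 * qform c u + l ^+ 2 * qform c v + 2 * (k * l) * polar c u v.
Proof. rewrite /qform /comb2 /polar /=; ring. Qed.

Lemma det2_scale k u l v :
  det2 (scale2 k u) (scale2 l v) = k * l * det2 u v :> R.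
Proof. rewrite /det2 /scale2 /=; ring. Qed.

Lemma det2_neq0l u v : det2 u v != 0 -> u <> (0, 0).
Proof. by move=> + uE; rewrite uE /det2 /= !mul0r subrr eqxx. Qed.

Lemma det2_neq0r u v : det2 u v != 0 -> v <> (0, 0).
Proof. by move=> + vE; rewrite vE /det2 /= !mulr0 subrr eqxx. Qed.

(** In [comb2 (- a) x1 b x2] with [a, b >= 0] one recognises the cone spanned by
    [- x1] and [x2].  The conditions are invariant under positive scaling of each
    of the four vectors, so only their directions matter. *)
Record interlaced c M x1 x2 y1 y2 : Prop := Interlaced {
  interlaced_x1 : qform c x1 = M * N x1 ^+ 2;
  interlaced_x2 : qform c x2 = M * N x2 ^+ 2;
  interlaced_y1 : qform c y1 = N y1 ^+ 2;
  interlaced_y2 : qform c y2 = N y2 ^+ 2;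
  interlaced_x : det2 x1 x2 != 0;
  interlaced_y : det2 y1 y2 != 0;
  interlaced_cone1 : exists a b, [/\ 0 <= a, 0 <= b & y1 = comb2 a x1 b x2];
  interlaced_cone2 : exists a b, [/\ 0 <= a, 0 <= b & y2 = comb2 (- a) x1 b x2] }.

Lemma collinear u v : v <> (0, 0) -> det2 u v = 0 -> exists k, u = scale2 k v.
Proof.
move=> v0; have [r [w [r0 wc ->]]] := circle_polar v0.
rewrite /det2 /scale2 /= => uv; exists ((u.1 * w.1 + u.2 * w.2) / r).
have {}uv : u.1 * w.2 = u.2 * w.1.
  by apply: (mulfI (x := r)); [rewrite gt_eqF|lra].
rewrite !mulrA !divfK ?gt_eqF//; case: u uv => a b /= uv.
move: wc; rewrite /circle /= => wc.
have [wca wcb] := (congr1 ( *%R a) wc, congr1 ( *%R b) wc).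
have [uv1 uv2] := (congr1 ( *%R w.1) uv, congr1 ( *%R w.2) uv).
by congr (_, _); lra.
Qed.

(** A common direction of both kinds of contact would give [M * N^2 = N^2] along
    a nonzero vector. *)
Lemma contact_det2_neq0 c M x y : sandwich N c M -> 1 < M ->
  x <> (0, 0) -> y <> (0, 0) ->
  qform c x = M * N x ^+ 2 -> qform c y = N y ^+ 2 -> det2 x y != 0.
Proof.
move=> sw M1 x0 y0 cx cy; apply/eqP => /(collinear y0)[k xE].
have := gauge_sqr_gt0 gN x0.
by move: cx; rewrite xE qform_scale (gauge_sqr_scale gN) cy; nra.
Qed.

(** With an inner contact [y0] as point at infinity, the other directions are
    given by their slope.  The form [d] vanishing at the least and the greatest
    outer slopes [t1], [t2] cannot separate the contacts, so that some inner
    contact [y] has its slope between [t1] and [t2].  Scaling the directions to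
    a common height over the axis of [y0], [x2 - x1] is [(t2 - t1) * y0]. *)
Lemma optimal_interlaced c M : optimal N c M ->
  exists x1 x2 y1 y2, interlaced c M x1 x2 y1 y2.
Proof.
move=> opt; have [sw _] := opt.
have := sandwich_ge1 sw; rewrite le_eqVlt => /orP[/eqP ME|M1].
  have cE v : qform c v = N v ^+ 2.
    by apply/eqP; rewrite eq_le andbC; have := sw v; rewrite -ME mul1r.
  (* [N] is Euclidean: every direction is a contact of both kinds *)
  exists (1, 0), (0, 1), (1, 0), (0, 1); split; rewrite -?ME ?mul1r ?cE//.
  - by rewrite /det2 /= mulr1 mulr0 subr0 oner_eq0.
  - by rewrite /det2 /= mulr1 mulr0 subr0 oner_eq0.
  - by exists 1, 0; split; rewrite // /comb2 /=; congr (_, _); ring.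
  - by exists 0, 1; split; rewrite // /comb2 /=; congr (_, _); ring.
have contact_neq0 := contact_det2_neq0 sw M1.
(* otherwise [q] itself could be scaled down *)
have [y0 [y0c cy0]] : exists y0, circle y0 /\ qform c y0 = N y0 ^+ 2.
  apply: contrapT => none; apply: (optimal_not_separated gN (d := lin_comb (-1) c 0 c) opt).
    by move=> v vc cv; exfalso; apply: none; exists v.
  move=> v vc cv; rewrite qform_lin_comb; have /andP[] := sw v.
  by have := sqr_ge0 (N v); lra.
pose K1 := @circle R `&` [set v | M * N v ^+ 2 - qform c v = 0].
have K1c : compact K1.
  apply: compact_closedI; first exact: circle_compact.
  apply: (@preimage_closed _ _ (fun v => M * N v ^+ 2 - qform c v) [set 0]).
    by move=> v _; exact: outer_gap_continuous.
  exact: closed_eq.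
have K1P v : K1 v -> circle v /\ qform c v = M * N v ^+ 2.
  by move=> [vc] /= /subr0_eq/esym.
have K10 : K1 !=set0.
  apply: contrapT => none; apply: (optimal_not_separated gN (d := c) opt).
    by move=> v /circle_neq0/(gauge_sqr_gt0 gN) + ->.
  by move=> v vc cv; exfalso; apply: none; exists v; split=> //=; rewrite cv subrr.
(* [m v] and [det2 y0 v] are the coordinates of [v] in the orthonormal frame
   [(p, q)], [(- q, p)], and the slope is their quotient *)
pose p := y0.1; pose q := y0.2; pose m v := p * v.1 + q * v.2.
have pq1 : p ^+ 2 + q ^+ 2 = 1 by [].
have det_neq0 v : K1 v -> det2 y0 v != 0.
  move=> /K1P[vc cv]; have := contact_neq0 _ _ (circle_neq0 vc) (circle_neq0 y0c) cv cy0.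
  by rewrite det2C oppr_eq0.
have slope_cont : {within K1, continuous (fun v => m v / det2 y0 v)}.
  apply: continuous_in_subspaceT => v /set_mem vK.
  have c1 := @continuous_fst R; have c2 := @continuous_snd R.
  apply: cvgM.
    apply: cvgD; (apply: cvgM; first exact: cvg_cst); [exact: c1|exact: c2].
  apply: cvgV; first exact: det_neq0.
  by apply: cvgB; (apply: cvgM; first exact: cvg_cst); [exact: c2|exact: c1].
have [v1 /set_mem v1K v1P] := compact_EVT_min K10 K1c slope_cont.
have [v2 /set_mem v2K v2P] := compact_EVT_max K10 K1c slope_cont.
have l10 := det_neq0 _ v1K; have l20 := det_neq0 _ v2K.
have [v1c cv1] := K1P _ v1K; have [v2c cv2] := K1P _ v2K.
set t1 := m v1 / _ in v1P; set t2 := m v2 / _ in v2P.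
have split_v v : v = (m v * p - det2 y0 v * q, m v * q + det2 y0 v * p).
  have [pq2 pq3] := (congr1 ( *%R v.1) pq1, congr1 ( *%R v.2) pq1).
  rewrite [LHS]surjective_pairing /m /det2 -/p -/q; congr (_, _); lra.
have frame v : det2 y0 v != 0 ->
    scale2 (det2 y0 v)^-1 v =
    (m v / det2 y0 v * p - q, m v / det2 y0 v * q + p).
  by move=> l0; rewrite /scale2 {2 4}[v]split_v /=; congr (_, _); field.
(* the coefficients of [(m - t1 * det2 y0) * (m - t2 * det2 y0)] *)
pose d : R * R * R := ((p + t1 * q) * (p + t2 * q),
  ((p + t1 * q) * (q - t2 * p) + (p + t2 * q) * (q - t1 * p)) / 2,
  (q - t1 * p) * (q - t2 * p)).
have dE v : qform d v = (m v - t1 * det2 y0 v) * (m v - t2 * det2 y0 v).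
  by rewrite /qform /d /m /det2 -/p -/q /=; field.
have dE' v : det2 y0 v != 0 -> qform d v =
    det2 y0 v ^+ 2 * ((m v / det2 y0 v - t1) * (m v / det2 y0 v - t2)).
  by move=> l0; rewrite dE; field.
have [y [yc cy dy]] : exists y, [/\ circle y, qform c y = N y ^+ 2 & qform d y <= 0].
  apply: contrapT => none; apply: (optimal_not_separated gN (d := d) opt) => v vc cv.
    by rewrite ltNge; apply/negP => dv; apply: none; exists v.
  have vK : K1 v by split=> //=; rewrite cv subrr.
  have := v1P v (mem_set vK); have := v2P v (mem_set vK); have := det_neq0 v vK.
  move=> l0 s2 s1; rewrite dE'// mulr_ge0_le0 ?sqr_ge0//.
  by rewrite mulr_ge0_le0 ?subr_ge0// subr_le0.
have l0 : det2 y0 y != 0.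
  apply/eqP => ly0; move: dy; rewrite dE ly0 !mulr0 !subr0 -expr2.
  have : m y != 0.
    apply/eqP => my0; apply: (circle_neq0 yc).
    by rewrite [y]split_v my0 ly0 !mul0r subrr addr0.
  by rewrite leNgt exprn_even_gt0//= => ->.
(* [t] differs from [t1] and [t2]: inner and outer directions are disjoint *)
have t12 : t1 <= t2 by apply: v1P; exact/mem_set.
set t := m y / det2 y0 y.
have det_slope v : det2 y0 v != 0 -> det2 v y = det2 y0 v * det2 y0 y * (m v / det2 y0 v - t).
  move=> lv0; transitivity ((p ^+ 2 + q ^+ 2) * (m v * det2 y0 y - det2 y0 v * m y)).
    by rewrite {1}[v]split_v {1}[y]split_v /det2 /=; ring.
  by rewrite pq1 /t; field; rewrite l0.
have tt1 : t != t1.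
  have := contact_neq0 _ _ (circle_neq0 v1c) (circle_neq0 yc) cv1 cy.
  by rewrite det_slope// -/t1; apply: contraNneq => ->; rewrite subrr mulr0.
have tt2 : t != t2.
  have := contact_neq0 _ _ (circle_neq0 v2c) (circle_neq0 yc) cv2 cy.
  by rewrite det_slope// -/t2; apply: contraNneq => ->; rewrite subrr mulr0.
have dt : (t - t1) * (t - t2) <= 0.
  have l2 : 0 < det2 y0 y ^+ 2 by rewrite exprn_even_gt0.
  by move: dy; rewrite dE'// -/t pmulr_rle0.
have /andP[t1t tt2'] : t1 < t < t2.
  by rewrite !lt_neqAle tt2 eq_sym tt1 /=; apply/andP; split; nra.
have t120 : t2 - t1 != 0 by rewrite gt_eqF// subr_gt0 (lt_trans t1t).
exists (scale2 (det2 y0 v1)^-1 v1), (scale2 (det2 y0 v2)^-1 v2),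
  (scale2 (det2 y0 y)^-1 y), y0.
split.
- by rewrite qform_scale cv1 (gauge_sqr_scale gN) mulrCA.
- by rewrite qform_scale cv2 (gauge_sqr_scale gN) mulrCA.
- by rewrite qform_scale cy (gauge_sqr_scale gN).
- by [].
- rewrite !frame// -/t1 -/t2.
  rewrite (_ : det2 _ _ = t1 - t2) ?subr_eq0 ?lt_eqF ?(lt_trans t1t)//.
  by rewrite /det2 /= -[RHS]mulr1 -pq1; ring.
- rewrite frame// -/t.
  rewrite (_ : det2 _ _ = -1) ?oppr_eq0 ?oner_eq0//.
  by rewrite /det2 /= -/p -/q -pq1; ring.
- exists ((t2 - t) / (t2 - t1)), ((t - t1) / (t2 - t1)); split.
  + by rewrite divr_ge0// subr_ge0 ltW// (lt_trans t1t).
  + by rewrite divr_ge0// subr_ge0 ltW// (lt_trans t1t).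
  + by rewrite !frame// /comb2 -/t -/t1 -/t2 /=; congr (_, _); field.
- exists (t2 - t1)^-1, (t2 - t1)^-1; split.
  + by rewrite invr_ge0 subr_ge0.
  + by rewrite invr_ge0 subr_ge0.
  + rewrite !frame// /comb2 -/t1 -/t2 /= [y0]surjective_pairing -/p -/q.
    by congr (_, _); field.
Qed.

End Alternation.

(** * Interlacing forces optimality and uniqueness *)

Section Sufficiency.
Variable R : realType.
Implicit Types (u v : R * R) (c d : R * R * R).
Variable N : R * R -> R.
Hypothesis gN : gauge N.

Lemma comb2_neq0 a u b v : comb2 a u b v <> (0, 0) -> 0 < a ^+ 2 + b ^+ 2.
Proof.
move=> w0; rewrite lt_neqAle addr_ge0 ?sqr_ge0// andbT eq_sym.
apply/eqP => /eqP; rewrite paddr_eq0 ?sqr_ge0// !sqrf_eq0 => /andP[/eqP a0 /eqP b0].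
by apply: w0; rewrite /comb2 a0 b0 !mul0r addr0.
Qed.

(** With [M' < M] the difference [d] of the forms is negative at [x1] and [x2],
    yet nonnegative at [y1] and [y2]; the first cone condition then makes its
    polar form positive at [(x1, x2)] and the second makes it negative. *)
Lemma interlaced_le c M x1 x2 y1 y2 c' M' :
  interlaced N c M x1 x2 y1 y2 -> sandwich N c' M' -> M <= M'.
Proof.
move=> [cx1 cx2 cy1 cy2 x12 y12 [a [b [a0 b0 y1E]]] [a' [b' [a'0 b'0 y2E]]]] sw.
rewrite leNgt; apply/negP => M'M.
pose d := lin_comb 1 c' (-1) c.
have dx x : x <> (0, 0) -> qform c x = M * N x ^+ 2 -> qform d x < 0.
  move=> /(gauge_sqr_gt0 gN) x0 cx; rewrite qform_lin_comb cx.
  by have /andP[] := sw x; nra.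
have dy y : qform c y = N y ^+ 2 -> 0 <= qform d y.
  by move=> cy; rewrite qform_lin_comb cy; have /andP[] := sw y; lra.
have d1 := dx _ (det2_neq0l x12) cx1; have d2 := dx _ (det2_neq0r x12) cx2.
have := dy _ cy1; have := dy _ cy2; have := det2_neq0l y12; have := det2_neq0r y12.
rewrite y1E y2E => /comb2_neq0 ab2' /comb2_neq0 ab2.
rewrite !qform_comb2 => h2 h1.
have neg k l : 0 < k ^+ 2 + l ^+ 2 -> k ^+ 2 * qform d x1 + l ^+ 2 * qform d x2 < 0.
  rewrite [_ + _ < 0]ltNge; apply: contraTN => h; rewrite -leNgt.
  have := mulr_ge0_le0 (sqr_ge0 k) (ltW d1).
  have := mulr_ge0_le0 (sqr_ge0 l) (ltW d2) => hl hk.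
  have k0 : k ^+ 2 <= 0 by rewrite -(nmulr_lge0 _ d1); lra.
  have l0 : l ^+ 2 <= 0 by rewrite -(nmulr_lge0 _ d2); lra.
  lra.
have {}h1 : 0 < (a * b) * polar d x1 x2 by have := neg _ _ ab2; lra.
have {}h2 : (a' * b') * polar d x1 x2 < 0 by have := neg _ _ ab2'; lra.
have [B0|/ltW B0] := leP (polar d x1 x2) 0.
  by have := mulr_ge0_le0 (mulr_ge0 a0 b0) B0; lra.
by have := mulr_ge0 (mulr_ge0 a'0 b'0) B0; lra.
Qed.

Lemma cramer x1 x2 v : det2 x1 x2 != 0 -> exists k l, v = comb2 k x1 l x2.
Proof.
move=> x12; exists (det2 v x2 / det2 x1 x2), (det2 x1 v / det2 x1 x2).
rewrite [LHS]surjective_pairing /comb2; move: x12; rewrite /det2 => x12.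
by congr (_, _); field.
Qed.

(** Here the difference [d] is only nonpositive at [x1] and [x2].  If [M > 1],
    inner and outer directions differ, so that the cone coefficients are
    positive and the polar form of [d] vanishes at [(x1, x2)]; then so does [d]
    at [x1] and [x2], which form a basis.  If [M = 1] both forms are [N^2]. *)
Lemma interlaced_unique c M x1 x2 y1 y2 c' :
  sandwich N c M -> interlaced N c M x1 x2 y1 y2 -> sandwich N c' M -> c' = c.
Proof.
move=> sw [cx1 cx2 cy1 cy2 x12 y12 [a [b [a0 b0 y1E]]] [a' [b' [a'0 b'0 y2E]]]] sw'.
have := sandwich_ge1 gN sw; rewrite le_eqVlt => /orP[/eqP ME|M1].
  by apply: qform_inj => v; have := sw v; have := sw' v; rewrite -ME; lra.
pose d := lin_comb 1 c' (-1) c.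
have dx x : qform c x = M * N x ^+ 2 -> qform d x <= 0.
  by move=> cx; rewrite qform_lin_comb cx; have /andP[] := sw' x; lra.
have dy y : qform c y = N y ^+ 2 -> 0 <= qform d y.
  by move=> cy; rewrite qform_lin_comb cy; have /andP[] := sw' y; lra.
have x10 := det2_neq0l x12; have x20 := det2_neq0r x12.
have y10 := det2_neq0l y12; have y20 := det2_neq0r y12.
have contact x y := contact_det2_neq0 gN sw M1 (x := x) (y := y).
have pos x y : 0 <= x -> x != 0 -> 0 <= y -> y != 0 -> 0 < x * y.
  by move=> *; rewrite mulr_gt0// lt_neqAle eq_sym; apply/andP.
have det_comb k l : det2 x1 (comb2 k x1 l x2) = l * det2 x1 x2 /\
    det2 x2 (comb2 k x1 l x2) = - k * det2 x1 x2.
  by rewrite /det2 /comb2 /=; split; ring.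
have ab : 0 < a * b.
  have := contact x1 y1 x10 y10 cx1 cy1; have := contact x2 y1 x20 y10 cx2 cy1.
  rewrite y1E; have [-> ->] := det_comb a b.
  by rewrite !mulf_eq0 !negb_or oppr_eq0 => /andP[? _] /andP[? _]; exact: pos.
have ab' : 0 < a' * b'.
  have := contact x1 y2 x10 y20 cx1 cy2; have := contact x2 y2 x20 y20 cx2 cy2.
  rewrite y2E; have [-> ->] := det_comb (- a') b'.
  by rewrite !mulf_eq0 !negb_or opprK => /andP[? _] /andP[? _]; exact: pos.
have d1 := dx _ cx1; have d2 := dx _ cx2.
have := dy _ cy1; have := dy _ cy2; rewrite y1E y2E !qform_comb2 => h2 h1.
have B_ge0 : 0 <= polar d x1 x2.
  have := mulr_ge0_le0 (sqr_ge0 a) d1; have := mulr_ge0_le0 (sqr_ge0 b) d2.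
  by rewrite -(pmulr_rge0 _ ab); lra.
have B_le0 : polar d x1 x2 <= 0.
  have := mulr_ge0_le0 (sqr_ge0 (- a')) d1; have := mulr_ge0_le0 (sqr_ge0 b') d2 => hb ha.
  by rewrite -(pmulr_rle0 _ ab'); lra.
have B0 : polar d x1 x2 = 0 by apply/eqP; rewrite eq_le B_le0.
move: h1; rewrite B0 mulr0 addr0 => h1.
have := mulr_ge0_le0 (sqr_ge0 a) d1; have := mulr_ge0_le0 (sqr_ge0 b) d2 => hb ha.
have [a_neq0 b_neq0] : a != 0 /\ b != 0.
  by apply/andP; rewrite -negb_or -mulf_eq0 gt_eqF.
have d10 : qform d x1 = 0.
  by apply: (mulfI (expf_neq0 2 a_neq0)); rewrite mulr0; lra.
have d20 : qform d x2 = 0.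
  by apply: (mulfI (expf_neq0 2 b_neq0)); rewrite mulr0; lra.
apply: qform_inj => v; have [k [l ->]] := cramer v x12.
have : qform d (comb2 k x1 l x2) = 0 by rewrite qform_comb2 d10 d20 B0 !mulr0 !addr0.
by rewrite qform_lin_comb; lra.
Qed.

Lemma interlaced_scale c M x1 x2 y1 y2 k1 k2 l1 l2 :
  0 < k1 -> 0 < k2 -> 0 < l1 -> 0 < l2 ->
  interlaced N c M x1 x2 y1 y2 ->
  interlaced N c M (scale2 k1 x1) (scale2 k2 x2) (scale2 l1 y1) (scale2 l2 y2).
Proof.
move=> k10 k20 l10 l20 [cx1 cx2 cy1 cy2 x12 y12 [a [b [a0 b0 y1E]]] [a' [b' [a'0 b'0 y2E]]]].
have kn1 : k1 != 0 by rewrite gt_eqF.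
have kn2 : k2 != 0 by rewrite gt_eqF.
have [k1w k2w l1w l2w] := And4 (ltW k10) (ltW k20) (ltW l10) (ltW l20).
split; rewrite ?qform_scale ?(gauge_sqr_scale gN) ?det2_scale.
- by rewrite cx1 mulrCA.
- by rewrite cx2 mulrCA.
- by rewrite cy1.
- by rewrite cy2.
- by apply: mulf_neq0 => //; rewrite gt_eqF ?mulr_gt0.
- by apply: mulf_neq0 => //; rewrite gt_eqF ?mulr_gt0.
- exists (l1 * a / k1), (l1 * b / k2); split.
  + by rewrite divr_ge0 ?mulr_ge0.
  + by rewrite divr_ge0 ?mulr_ge0.
  + by rewrite y1E /scale2 /comb2 /=; congr (_, _); field; rewrite kn1 kn2.
- exists (l2 * a' / k1), (l2 * b' / k2); split.
  + by rewrite divr_ge0 ?mulr_ge0.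
  + by rewrite divr_ge0 ?mulr_ge0.
  + by rewrite y2E /scale2 /comb2 /=; congr (_, _); field; rewrite kn1 kn2.
Qed.

Lemma interlaced_normalize c M x1 x2 y1 y2 : interlaced N c M x1 x2 y1 y2 ->
  exists u1 u2 v1 v2, interlaced N c M u1 u2 v1 v2 /\
    [/\ N u1 = 1, N u2 = 1, N v1 = 1 & N v2 = 1].
Proof.
move=> H; have [_ _ _ _ x12 y12 _ _] := H.
have pos u : u <> (0, 0) -> 0 < (N u)^-1.
  by move=> u0; rewrite invr_gt0 (gauge_gt0 gN).
have unit u : u <> (0, 0) -> N (scale2 (N u)^-1 u) = 1.
  move=> u0; have Nu := gauge_gt0 gN u0.
  by rewrite (gauge_scale gN) gtr0_norm ?invr_gt0// mulVf// gt_eqF.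
have x10 := det2_neq0l x12; have x20 := det2_neq0r x12.
have y10 := det2_neq0l y12; have y20 := det2_neq0r y12.
exists (scale2 (N x1)^-1 x1), (scale2 (N x2)^-1 x2),
  (scale2 (N y1)^-1 y1), (scale2 (N y2)^-1 y2); split.
  by apply: interlaced_scale => //; exact: pos.
by split; exact: unit.
Qed.

Lemma unit_det2P u v : N u = 1 -> N v = 1 ->
  det2 u v != 0 <-> u <> v /\ u <> scale2 (-1) v.
Proof.
move=> u1 v1; split=> [uv|[uv uNv]].
  split=> uE; move: uv; rewrite uE /det2 /scale2 /= => /eqP; apply; ring.
apply/eqP => /collinear[|k uE].
  by move=> v0; move: v1; rewrite v0 (gauge0 gN) => /eqP; rewrite eq_sym oner_eq0.
move: u1; rewrite uE (gauge_scale gN) v1 mulr1 => /eqP.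
rewrite eqr_norml ler01 andbT => /orP[] /eqP kE.
  by apply: uv; rewrite uE kE /scale2 !mul1r -surjective_pairing.
by apply: uNv; rewrite uE kE.
Qed.

End Sufficiency.

(** * Linear maps and their norms *)

Section LinearMaps.
Variables (R : realType) (X Y : normedModType R).

Lemma linear_of (f : X -> Y) : linear f -> exists T : {linear X -> Y}, T =1 f.
Proof.
move=> lf.
pose T : {linear X -> Y} := HB.pack f (GRing.isLinear.Build R X Y *:%R f lf).
by exists T.
Qed.

Lemma linear_ext (S T : {linear X -> Y}) : S =1 T -> S = T.
Proof.
case: S T => [f [[f1] [f2]]] [g [[g1] [g2]]] /= /funext fg.
subst g; by rewrite (Prop_irrelevance f1 g1) (Prop_irrelevance f2 g2).
Qed.

Lemma continuous_bounded (T : {linear X -> Y}) :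
  continuous T <-> exists C, forall x, `|T x| <= C * `|x|.
Proof.
rewrite -linear_bounded_continuous linear_boundedP; split.
  by move=> [M [_ HM]]; exists (M + 1); apply: HM; rewrite ltrDl.
move=> [C HC]; exists C; split; first exact: num_real.
by move=> r Cr x; apply: le_trans (HC x) _; rewrite ler_wpM2r// ltW.
Qed.

Lemma opnorm_bound (T : {linear X -> Y}) C :
  (forall x, `|T x| <= C * `|x|) -> forall x, `|T x| <= opnorm T * `|x|.
Proof.
move=> HC x; have [->|x0] := eqVneq x 0; first by rewrite linear0 !normr0 mulr0.
have nx : 0 < `|x| by rewrite normr_gt0.
rewrite -ler_pdivrMr//; apply: ub_le_sup; last first.
  exists (`|x|^-1 *: x).
    by rewrite /unit_sphere /= normrZ normfV normr_id mulVf// gt_eqF.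
  by rewrite linearZ normrZ normfV normr_id mulrC.
by exists C => _ [z z1 <-]; rewrite -[C]mulr1 -z1.
Qed.

Lemma opnorm_le (T : {linear X -> Y}) (x0 : X) C : x0 != 0 ->
  (forall x, `|T x| <= C * `|x|) -> opnorm T <= C.
Proof.
move=> x00 HC; apply: ge_sup; last by move=> _ [z z1 <-]; rewrite -[C]mulr1 -z1.
exists (`|T (`|x0|^-1 *: x0)|), (`|x0|^-1 *: x0) => //.
by rewrite /unit_sphere /= normrZ normfV normr_id mulVf// normr_eq0.
Qed.

Lemma opnorm_ge0 (T : {linear X -> Y}) (x0 : X) C : x0 != 0 ->
  (forall x, `|T x| <= C * `|x|) -> 0 <= opnorm T.
Proof.
move=> x00 /opnorm_bound/(_ x0)/(le_trans (normr_ge0 _)).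
by rewrite pmulr_lge0// normr_gt0.
Qed.

End LinearMaps.

(** * Coordinates and the form of an operator *)

Section Coordinates.
Variables (R : realType) (X : normedModType R) (e : 'I_2 -> X).
Hypothesis he : is_basis e.
Local Notation E := (euclidean2 R).
Implicit Types (u v : R * R) (c d : R * R * R).

Definition of_coord v : X := v.1 *: e ord0 + v.2 *: e ord_max.

Lemma sum2E (V : nmodType) (F : 'I_2 -> V) : \sum_(i < 2) F i = F ord0 + F ord_max.
Proof. by rewrite !big_ord_recl big_ord0 addr0; congr (_ + F _); apply: val_inj. Qed.

Lemma ord2P (i : 'I_2) : i = ord0 \/ i = ord_max.
Proof.
by case: i => [[|[|//]] i2]; [left|right]; apply: val_inj.
Qed.

Lemma of_coord0 : of_coord (0, 0) = 0.
Proof. by rewrite /of_coord /= !scale0r addr0. Qed.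

Lemma of_coord_comb2 k u l v :
  of_coord (comb2 k u l v) = k *: of_coord u + l *: of_coord v.
Proof. by rewrite /of_coord /comb2 /= !scalerDl !scalerDr !scalerA addrACA. Qed.

Lemma of_coord_scale2 k v : of_coord (scale2 k v) = k *: of_coord v.
Proof. by rewrite /of_coord /scale2 /= scalerDr !scalerA. Qed.

Lemma of_coord_eq0 v : of_coord v = 0 -> v = (0, 0).
Proof.
case: v => a b ab0; have [free _] := he.
have := free (fun i => if i == ord0 then a else b).
rewrite sum2E /= => /(_ ab0) H.
by congr (_, _); [exact: (H ord0)|exact: (H ord_max)].
Qed.

Lemma of_coord_surj x : exists v, x = of_coord v.
Proof.
by have [_ /(_ x)[c ->]] := he; exists (c ord0, c ord_max); rewrite sum2E.
Qed.

Definition to_coord x : R * R := sval (cid (of_coord_surj x)).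

Lemma to_coordK x : of_coord (to_coord x) = x.
Proof. by rewrite /to_coord; case: cid. Qed.

Lemma of_coord_inj : injective of_coord.
Proof.
move=> u v uv; have := @of_coord_eq0 (comb2 1 u (-1) v).
rewrite of_coord_comb2 uv scale1r scaleN1r subrr /comb2 => /(_ erefl)[? ?].
by rewrite [u]surjective_pairing [v]surjective_pairing; congr (_, _); lra.
Qed.

Lemma of_coordK v : to_coord (of_coord v) = v.
Proof. by apply: of_coord_inj; rewrite to_coordK. Qed.

Lemma to_coord_linear k x y : to_coord (k *: x + y) = comb2 k (to_coord x) 1 (to_coord y).
Proof. by apply: of_coord_inj; rewrite of_coord_comb2 !to_coordK scale1r. Qed.

Definition coord_norm v : R := `|of_coord v|.

Lemma coord_norm_gauge : gauge coord_norm.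
Proof.
split.
- move=> v; apply: (cvg_comp of_coord Num.norm); last exact: norm_continuous.
  by apply: cvgD; apply: cvgZr_tmp; [exact: cvg_fst|exact: cvg_snd].
- by move=> k v; rewrite /coord_norm of_coord_scale2 normrZ.
- by move=> v v0; rewrite normr_gt0; apply/eqP => /of_coord_eq0.
Qed.

Lemma euclidean2_sqr (y : E) :
  `|y| ^+ 2 = (y : 'cV[R]_2) ord0 0 ^+ 2 + (y : 'cV[R]_2) ord_max 0 ^+ 2.
Proof.
rewrite [`|y|]/(euclidean_norm y) /euclidean_norm sum2E.
by rewrite sqr_sqrtr// addr_ge0// sqr_ge0.
Qed.

(** The Gram matrix of the columns of [matrix_in e T]: the form
    [v |-> |T v|^2] in coordinates. *)
Definition map_form (T : {linear X -> E}) : R * R * R :=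
  let A := matrix_in e T in
  (A ord0 ord0 ^+ 2 + A ord_max ord0 ^+ 2,
   A ord0 ord0 * A ord0 ord_max + A ord_max ord0 * A ord_max ord_max,
   A ord0 ord_max ^+ 2 + A ord_max ord_max ^+ 2).

Lemma map_of_coord (T : {linear X -> E}) v i :
  (T (of_coord v) : 'cV[R]_2) i 0 =
  matrix_in e T i ord0 * v.1 + matrix_in e T i ord_max * v.2.
Proof. by rewrite linearD !linearZ !mxE mulrC [v.2 * _]mulrC. Qed.

Lemma map_formE (T : {linear X -> E}) v :
  qform (map_form T) v = `|T (of_coord v)| ^+ 2.
Proof. by rewrite euclidean2_sqr !map_of_coord /qform /map_form /=; ring. Qed.

Lemma linear_of_matrix (A : 'M[R]_2) :
  exists T : {linear X -> E}, matrix_in e T = A.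
Proof.
have [|T TE] := @linear_of R X E (fun x => \col_i
    (A i ord0 * (to_coord x).1 + A i ord_max * (to_coord x).2)).
  by move=> k x y; apply/matrixP => i j; rewrite to_coord_linear !mxE /comb2 /=; ring.
exists T; apply/matrixP => i j; rewrite mxE TE mxE.
have -> : e j = of_coord ((j == ord0)%:R, (j != ord0)%:R).
  rewrite /of_coord; case: (ord2P j) => -> /=.
    by rewrite scale1r scale0r addr0.
  by rewrite scale1r scale0r add0r.
by rewrite of_coordK /=; case: (ord2P j) => -> /=; ring.
Qed.

End Coordinates.

(** * Positive definite square roots and the Banach-Mazur distance *)

Section SquareRoot.
Variables (R : realType) (X : normedModType R) (e : 'I_2 -> X).
Hypothesis he : is_basis e.
Local Notation E := (euclidean2 R).
Local Notation N := (coord_norm e).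
Implicit Types (u v : R * R) (c d : R * R * R) (T : {linear X -> E}).

Definition sym_mx c : 'M[R]_2 :=
  \matrix_(i, j) (if i == j then if i == ord0 then c.1.1 else c.2 else c.1.2).

Lemma sym_mxP (A : 'M[R]_2) : A^T = A ->
  A = sym_mx (A ord0 ord0, A ord0 ord_max, A ord_max ord_max).
Proof.
move=> AT; apply/matrixP => i j; rewrite mxE.
by case: (ord2P i) => ->; case: (ord2P j) => -> //=; rewrite -{1}AT mxE.
Qed.

Lemma sym_mx_quadratic c (v : 'cV[R]_2) :
  (v^T *m sym_mx c *m v) 0 0 = qform c (v ord0 0, v ord_max 0).
Proof. by rewrite !mxE !sum2E !mxE !sum2E !mxE /qform /=; ring. Qed.

Lemma posdef_sym_mx c : posdefmx (sym_mx c) <->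
  forall v, v <> (0, 0) -> 0 < qform c v.
Proof.
split=> H v v0.
  have := H (\col_i if i == ord0 then v.1 else v.2).
  rewrite sym_mx_quadratic !mxE /= -surjective_pairing; apply.
  apply/eqP => /matrixP v00; apply: v0; rewrite [v]surjective_pairing.
  by have := v00 ord0 0; have := v00 ord_max 0; rewrite !mxE /= => -> ->.
rewrite sym_mx_quadratic; apply: H => -[va vb]; move/eqP: v0; apply.
by apply/matrixP => i j; rewrite (ord1 j) mxE; case: (ord2P i) => ->.
Qed.

(** Completing the square, [c.1.1 * qform c] is a square plus the determinant
    times a square. *)
Lemma qform_posdefP c : (forall v, v <> (0, 0) -> 0 < qform c v) <->
  0 < c.1.1 /\ 0 < c.1.1 * c.2 - c.1.2 ^+ 2.
Proof.
split=> [H|[c10 D0] [a b] ab0].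
  have c10 : 0 < c.1.1.
    have /H : (1, 0) <> (0, 0) :> R * R by case=> /eqP; rewrite oner_eq0.
    by rewrite /qform /=; lra.
  split=> //.
  have /H : (- c.1.2, c.1.1) <> (0, 0) by case=> _ c11; rewrite c11 ltxx in c10.
  rewrite /qform /= => h; rewrite -(pmulr_rgt0 _ c10); lra.
rewrite -(pmulr_rgt0 _ c10).
have -> : c.1.1 * qform c (a, b) =
    (c.1.1 * a + c.1.2 * b) ^+ 2 + (c.1.1 * c.2 - c.1.2 ^+ 2) * b ^+ 2.
  by rewrite /qform /=; ring.
have [b0|b0] := eqVneq b 0; last first.
  by rewrite ltr_wpDl ?sqr_ge0// mulr_gt0// exprn_even_gt0.
have [a0|a0] := eqVneq a 0; first by case: ab0; rewrite a0 b0.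
by rewrite b0 !mulr0 expr0n /= mulr0 !addr0 exprn_even_gt0// mulf_neq0// gt_eqF.
Qed.

(** The coefficients of [v |-> |A v|^2] for [A = sym_mx c], that is, of the form
    of the matrix [A ^+ 2]. *)
Definition sqr_form c : R * R * R :=
  (c.1.1 ^+ 2 + c.1.2 ^+ 2, c.1.2 * (c.1.1 + c.2), c.1.2 ^+ 2 + c.2 ^+ 2).

Lemma map_form_sym T c : matrix_in e T = sym_mx c -> map_form e T = sqr_form c.
Proof. by move=> TE; rewrite /map_form TE !mxE /=; congr (_, _, _); ring. Qed.

(** By Cayley-Hamilton, [A^2 + det A = tr A * A] for a 2 x 2 matrix, and
    [A^2] determines [det A] and [tr A] when they are positive:
    [(det A)^2 = det (A^2)] and [(tr A)^2 = tr (A^2) + 2 det A]. *)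
Lemma sqr_form_inj a c :
  0 < a.1.1 -> 0 < a.1.1 * a.2 - a.1.2 ^+ 2 ->
  0 < c.1.1 -> 0 < c.1.1 * c.2 - c.1.2 ^+ 2 ->
  sqr_form a = sqr_form c -> a = c.
Proof.
case: a c => [[a1 a2] a3] [[c1 c2] c3]; rewrite /sqr_form /= => a0 Da c0 Dc.
move=> [h1 h2 h3].
have hD : a1 * a3 - a2 ^+ 2 = c1 * c3 - c2 ^+ 2.
  apply/eqP; rewrite -(eqrXn2 (n := 2)) ?ltW//; apply/eqP.
  transitivity ((a1 ^+ 2 + a2 ^+ 2) * (a2 ^+ 2 + a3 ^+ 2) - (a2 * (a1 + a3)) ^+ 2).
    by ring.
  by rewrite h1 h2 h3; ring.
have a30 : 0 < a3 by rewrite -(pmulr_rgt0 _ a0); have := sqr_ge0 a2; lra.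
have c30 : 0 < c3 by rewrite -(pmulr_rgt0 _ c0); have := sqr_ge0 c2; lra.
have ht : a1 + a3 = c1 + c3.
  apply/eqP; rewrite -(eqrXn2 (n := 2)) ?ltW ?addr_gt0//; apply/eqP; lra.
have t0 : a1 + a3 != 0 by rewrite gt_eqF// addr_gt0.
have E2 : a2 = c2 by apply: (mulIf t0); rewrite h2 ht.
have E1 : a1 = c1.
  apply: (mulIf t0); rewrite {2}ht; subst a2; lra.
by congr (_, _, _) => //; lra.
Qed.

(** The square root of [C] given by Cayley-Hamilton is [(C + d) / t] with
    [d = sqrt (det C)] and [t = sqrt (tr C + 2 d)]. *)
Lemma sqr_form_surj c : 0 < c.1.1 -> 0 < c.1.1 * c.2 - c.1.2 ^+ 2 ->
  exists a, [/\ 0 < a.1.1, 0 < a.1.1 * a.2 - a.1.2 ^+ 2 & sqr_form a = c].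
Proof.
case: c => [[p q] r] /= p0 D0; set D := _ - _ in D0.
have r0 : 0 < r by rewrite -(pmulr_rgt0 _ p0); have := sqr_ge0 q; rewrite /D in D0; lra.
pose d := Num.sqrt D; have d0 : 0 < d by rewrite sqrtr_gt0.
have dE : d ^+ 2 = p * r - q ^+ 2 by rewrite sqr_sqrtr// ltW.
have s0 : 0 < p + r + 2 * d by lra.
pose t := Num.sqrt (p + r + 2 * d); have t0 : 0 < t by rewrite sqrtr_gt0.
have tE : t ^+ 2 = p + r + 2 * d by rewrite sqr_sqrtr// ltW.
have t20 : t ^+ 2 != 0 by rewrite expf_neq0// gt_eqF.
have tn0 : t != 0 by rewrite gt_eqF.
exists ((p + d) / t, q / t, (r + d) / t) => /=; split.
- by rewrite divr_gt0// addr_gt0.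
- rewrite (_ : _ - _ = d)//; apply: (mulIf t20).
  transitivity (p * r - q ^+ 2 + d * (p + r) + d ^+ 2); first by field.
  by rewrite -dE tE; ring.
- rewrite /sqr_form /=; congr (_, _, _); apply: (mulIf t20).
  + transitivity (p ^+ 2 + 2 * p * d + d ^+ 2 + q ^+ 2); first by field.
    by rewrite dE tE; ring.
  + transitivity (q * (p + r + 2 * d)); first by field.
    by rewrite tE.
  + transitivity (r ^+ 2 + 2 * r * d + d ^+ 2 + q ^+ 2); first by field.
    by rewrite dE tE; ring.
Qed.

Lemma PD_sym_mx T : PD e T -> exists c, [/\ matrix_in e T = sym_mx c,
  0 < c.1.1 & 0 < c.1.1 * c.2 - c.1.2 ^+ 2].
Proof.
move=> [/sym_mxP TE]; rewrite TE => /posdef_sym_mx/qform_posdefP[? ?].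
by eexists; split; first reflexivity.
Qed.

Lemma sym_mx_PD T c : matrix_in e T = sym_mx c ->
  0 < c.1.1 -> 0 < c.1.1 * c.2 - c.1.2 ^+ 2 -> PD e T.
Proof.
move=> TE c0 D0; split; rewrite TE; last exact/posdef_sym_mx/qform_posdefP.
apply/matrixP => i j; rewrite !mxE eq_sym.
by case: eqP => // ->.
Qed.

Lemma matrix_in_inj S T : matrix_in e S = matrix_in e T -> S = T.
Proof.
move=> ST; apply: linear_ext => x; rewrite -(to_coordK he x).
by apply/matrixP => i j; rewrite (ord1 j) !map_of_coord ST.
Qed.

Lemma PD_map_form_inj S T : PD e S -> PD e T ->
  map_form e S = map_form e T -> S = T.
Proof.
move=> /PD_sym_mx[a [SE a0 Da]] /PD_sym_mx[c [TE c0 Dc]].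
rewrite (map_form_sym SE) (map_form_sym TE) => /sqr_form_inj H.
by apply: matrix_in_inj; rewrite SE TE H.
Qed.

Lemma PD_with_form c : (forall v, v <> (0, 0) -> 0 < qform c v) ->
  exists T, PD e T /\ map_form e T = c.
Proof.
move=> /qform_posdefP[c0 D0]; have [a [a0 Da <-]] := sqr_form_surj c0 D0.
have [T TE] := linear_of_matrix he (sym_mx a).
by exists T; split; [exact: sym_mx_PD Da|exact: map_form_sym].
Qed.

Lemma PD_surj T : PD e T -> exists S : {linear E -> X}, cancel S T.
Proof.
move=> /PD_sym_mx[a [TE a0 Da]].
pose D := a.1.1 * a.2 - a.1.2 ^+ 2.
have Dn : D != 0 by rewrite gt_eqF.
pose f (y : E) := let w : 'cV[R]_2 := y in of_coord e
  ((a.2 * w ord0 0 - a.1.2 * w ord_max 0) / D,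
   (a.1.1 * w ord_max 0 - a.1.2 * w ord0 0) / D).
have lf : linear f.
  move=> k x y; rewrite /f -[X in _ = _ + X]scale1r -of_coord_comb2.
  by congr of_coord; rewrite /comb2 !mxE /=; congr (_, _); field.
have [S SE] := linear_of lf.
exists S => y; rewrite SE; apply/matrixP => i j; rewrite (ord1 j) map_of_coord TE.
by case: (ord2P i) => ->; rewrite !mxE /=; move: Dn; rewrite /D => Dn; field.
Qed.

Lemma map_sandwichP T K : 0 <= K ->
  sandwich N (map_form e T) (K ^+ 2) <-> forall x, `|x| <= `|T x| <= K * `|x|.
Proof.
move=> K0; split=> H.
  move=> x; rewrite -(to_coordK he x); have := H (to_coord he x).
  rewrite map_formE /coord_norm -exprMn !ler_sqr ?nnegrE ?normr_ge0//.
  by rewrite mulr_ge0.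
move=> v; rewrite map_formE /coord_norm -exprMn !ler_sqr ?nnegrE ?normr_ge0//.
by rewrite mulr_ge0.
Qed.

(** On the circle [N^2 - k |T v|^2] stays positive for small [k > 0]. *)
Lemma map_bounded T : exists C, forall x, `|T x| <= C * `|x|.
Proof.
have gN := coord_norm_gauge he.
have Nc := gauge_sqr_continuous gN; set d := map_form e T.
have N0 v : circle v -> 0 < N v ^+ 2.
  by move=> /circle_neq0; exact: gauge_sqr_gt0.
have [k k0 kP] : exists2 k, 0 < k & forall l, 0 < l <= k -> forall v,
    circle v -> 0 < N v ^+ 2 + l * qform (lin_comb (-1) d 0 d) v.
  apply: circle_perturb => //; first exact: qform_continuous.
    by move=> v /N0/ltW.
  by move=> v /N0 + eq0; rewrite eq0 ltxx.
exists (Num.sqrt k^-1) => x; have [v ->] := of_coord_surj he x.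
have [->|/circle_polar[r [u [r0 uc ->]]]] := pselect (v = (0, 0)).
  by rewrite of_coord0 linear0 !normr0 mulr0.
rewrite of_coord_scale2 linearZ !normrZ mulrCA ler_wpM2l//.
rewrite -(ler_sqr (R := R)) ?nnegrE ?mulr_ge0 ?sqrtr_ge0//.
have kV0 : 0 <= k^-1 by rewrite invr_ge0 ltW.
rewrite exprMn (sqr_sqrtr kV0) [k^-1 * _]mulrC ler_pdivlMr// -map_formE -/d.
have := kP k; rewrite k0 lexx => /(_ isT u uc).
by rewrite qform_lin_comb /coord_norm; lra.
Qed.

Lemma e0_neq0 : e ord0 != 0.
Proof.
apply/eqP => e00; have := @of_coord_eq0 _ _ _ he (1, 0).
rewrite /of_coord /= e00 scaler0 scale0r addr0 => /(_ erefl)[/eqP].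
by rewrite oner_eq0.
Qed.

Lemma unit_ball_imageP T : PD e T ->
  unit_ball E `<=` T @` unit_ball X <-> forall x, `|x| <= `|T x|.
Proof.
move=> TPD; have [S ST] := PD_surj TPD.
have Tinj x : T x = 0 -> x = 0.
  move=> Tx0; have [a [TE a0 Da]] := PD_sym_mx TPD.
  have pos : forall v, v <> (0, 0) -> 0 < qform a v by exact/qform_posdefP.
  move: Tx0; rewrite -(to_coordK he x); move: (to_coord he x) => v Tv0.
  have [->|/pos] := pselect (v = (0, 0)); first by rewrite of_coord0.
  have Tv i : (T (of_coord e v) : 'cV[R]_2) i 0 = 0 by rewrite Tv0 mxE.
  have -> : qform a v = v.1 * (T (of_coord e v) : 'cV[R]_2) ord0 0
      + v.2 * (T (of_coord e v) : 'cV[R]_2) ord_max 0.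
    by rewrite !map_of_coord TE !mxE /qform /=; ring.
  by rewrite !Tv !mulr0 addr0 ltxx.
split=> [H x|H y y1]; last first.
  by exists (S y) => //; apply: le_trans (H _) _; rewrite ST.
have [Tx0|Tx0] := eqVneq (T x) 0; first by rewrite Tx0 (Tinj x Tx0) normr0.
have nT : 0 < `|T x| by rewrite normr_gt0.
have [|z z1 zE] := H (`|T x|^-1 *: T x).
  by rewrite /unit_ball /= normrZ normfV normr_id mulVf// gt_eqF.
have xE : x = `|T x| *: z.
  apply/eqP; rewrite -subr_eq0; apply/eqP/Tinj.
  by rewrite linearB linearZ /= zE scalerA divff ?gt_eqF// scale1r subrr.
by rewrite {1}xE normrZ normr_id -[leRHS]mulr1 ler_wpM2l.
Qed.

(** The square root [T] of the optimal form realises [sqrt M], as its inverse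
    has norm at most 1.  Conversely an isomorphism [T'] with inverse [S'] gives
    the sandwiched form [|S'|^2 * |T' v|^2], whose bound is
    [(|S'| * |T'|)^2]. *)
Lemma optimal_d2 c M : optimal N c M -> d2 X = Num.sqrt M.
Proof.
move=> [sw opt]; have gN := coord_norm_gauge he.
have M1 := sandwich_ge1 gN sw.
have sM0 := sqrtr_ge0 M.
have sME : Num.sqrt M ^+ 2 = M by rewrite sqr_sqrtr//; lra.
have [T [TPD TE]] : exists T, PD e T /\ map_form e T = c.
  apply: (PD_with_form) => v v0.
  by have /andP[+ _] := sw v; apply: lt_le_trans; exact: gauge_sqr_gt0.
have Tb : forall x, `|x| <= `|T x| <= Num.sqrt M * `|x|.
  by apply/map_sandwichP => //; rewrite TE sME.
have [S ST] := PD_surj TPD.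
have TS : cancel T S.
  move=> x; apply/eqP; rewrite -subr_eq0 -normr_le0.
  have /andP[+ _] := Tb (S (T x) - x); rewrite linearB ST subrr normr0; apply.
have Sb y : `|S y| <= 1 * `|y|.
  by rewrite mul1r -{2}(ST y); have /andP[] := Tb (S y).
have Tb' x : `|T x| <= Num.sqrt M * `|x| by have /andP[] := Tb x.
have iso : is_isomorphism T S.
  by split=> //; apply/continuous_bounded; [exists (Num.sqrt M)|exists 1].
have lb : lbound [set r | exists (T : {linear X -> E}) (S : {linear E -> X}),
    is_isomorphism T S /\ r = opnorm T * opnorm S] (Num.sqrt M).
  move=> _ [T' [S' [[TS' ST' /continuous_bounded[C1 HC1] /continuous_bounded[C2 HC2]] ->]]].
  have T'0 := opnorm_ge0 e0_neq0 HC1.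
  have Te0 : T' (e ord0) != 0.
    by apply: contraNneq e0_neq0 => Te0; rewrite -(TS' (e ord0)) Te0 linear0.
  have S'0 := opnorm_ge0 Te0 HC2.
  rewrite -[leRHS]ger0_norm ?mulr_ge0// -sqrtr_sqr ler_sqrt ?sqr_ge0//.
  apply: (opt (lin_comb (opnorm S' ^+ 2) (map_form e T') 0 (map_form e T'))) => v.
  rewrite qform_lin_comb mul0r addr0 map_formE /coord_norm -!exprMn.
  rewrite !ler_sqr ?nnegrE ?mulr_ge0//; apply/andP; split.
    by have := opnorm_bound HC2 (T' (of_coord e v)); rewrite TS'.
  rewrite [opnorm T' * _]mulrC -mulrA ler_wpM2l//; exact: opnorm_bound HC1 _.
apply/eqP; rewrite eq_le; apply/andP; split; last first.
  by apply: lb_le_inf => //; exists (opnorm T * opnorm S), T, S.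
apply: (@le_trans _ _ (opnorm T * opnorm S)).
  by apply: ge_inf; [exists (Num.sqrt M)|exists T, S].
have Te0 : T (e ord0) != 0.
  by apply: contraNneq e0_neq0 => Te0; rewrite -(TS (e ord0)) Te0 linear0.
have S1 := opnorm_le Te0 Sb; have T1 := opnorm_le e0_neq0 Tb'.
rewrite -[leRHS]mulr1 ler_pM//; [exact: opnorm_ge0 e0_neq0 Tb'|exact: opnorm_ge0 Te0 Sb].
Qed.

End SquareRoot.

(** * The contact points in the normed space *)

Section Transfer.
Variables (R : realType) (X : normedModType R) (e : 'I_2 -> X).
Hypothesis he : is_basis e.
Local Notation N := (coord_norm e).

Lemma interlaced_of_coord (T : {linear X -> euclidean2 R}) K : 0 <= K ->
  (exists x1 x2 y1 y2, interlaced N (map_form e T) (K ^+ 2) x1 x2 y1 y2) <->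
  exists x1 x2 y1 y2 : X,
    [/\ unit_sphere X x1, unit_sphere X x2, x1 <> x2 & x1 <> - x2] /\
    [/\ unit_sphere X y1, unit_sphere X y2, y1 <> y2 & y1 <> - y2] /\
    [/\ `|T x1| = K, `|T x2| = K, `|T y1| = 1 & `|T y2| = 1] /\
    cone x1 x2 y1 /\ cone (- x1) x2 y2.
Proof.
move=> K0; have gN := coord_norm_gauge he.
have oppE v : - of_coord e v = of_coord e (scale2 (-1) v).
  by rewrite of_coord_scale2 scaleN1r.
have sqrK (k l : R) : 0 <= k -> 0 <= l -> k ^+ 2 = l ^+ 2 -> k = l.
  by move=> k0 l0 /eqP; rewrite eqrXn2// => /eqP.
split=> [[? [? [? [? /(interlaced_normalize gN)]]]]|].
  move=> [x1 [x2 [y1 [y2 [[]]]]]].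
  rewrite !map_formE => cx1 cx2 cy1 cy2 x12 y12 [a [b [a0 b0 y1E]]]
    [a' [b' [a'0 b'0 y2E]]] [x11 x21 y11 y21].
  move: cx1 cx2 cy1 cy2; rewrite x11 x21 y11 y21 !expr1n !mulr1 => cx1 cx2 cy1 cy2.
  have [x12n x12N] := (unit_det2P gN x11 x21).1 x12.
  have [y12n y12N] := (unit_det2P gN y11 y21).1 y12.
  exists (of_coord e x1), (of_coord e x2), (of_coord e y1), (of_coord e y2).
  rewrite !oppE; split; [|split; [|split; [|split]]].
  - by split=> // /(of_coord_inj he).
  - by split=> // /(of_coord_inj he).
  - by split; apply: sqrK; rewrite ?expr1n.
  - by exists a, b; rewrite y1E of_coord_comb2.
  - exists a', b'; split=> //.
    by rewrite y2E of_coord_comb2 of_coord_scale2 scalerA mulrN1.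
move=> [x1 [x2 [y1 [y2]]]].
have [u1 ->] := of_coord_surj he x1; have [u2 ->] := of_coord_surj he x2.
have [v1 ->] := of_coord_surj he y1; have [v2 ->] := of_coord_surj he y2.
rewrite !oppE => -[[x11 x21 x12 x12N] [[y11 y21 y12 y12N] [[Tx1 Tx2 Ty1 Ty2]]]].
move=> [[a [b [a0 b0 y1E]]] [a' [b' [a'0 b'0 y2E]]]].
rewrite /unit_sphere /= in x11 x21 y11 y21.
exists u1, u2, v1, v2; split.
- by rewrite map_formE Tx1 /coord_norm x11 expr1n mulr1.
- by rewrite map_formE Tx2 /coord_norm x21 expr1n mulr1.
- by rewrite map_formE Ty1 /coord_norm y11.
- by rewrite map_formE Ty2 /coord_norm y21.
- by apply/(unit_det2P gN) => //; split=> uv; [apply: x12|apply: x12N]; rewrite uv.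
- by apply/(unit_det2P gN) => //; split=> uv; [apply: y12|apply: y12N]; rewrite uv.
- by exists a, b; split=> //; apply: (of_coord_inj he); rewrite of_coord_comb2.
- exists a', b'; split=> //; apply: (of_coord_inj he).
  by rewrite y2E of_coord_comb2 of_coord_scale2 scalerA mulrN1.
Qed.

End Transfer.

Theorem theorem1 (R : realType) (X : normedModType R) (e : 'I_2 -> X)
    (he : is_basis e) :
  (exists! T : {linear X -> euclidean2 R},
     [/\ PD e T,
         unit_ball (euclidean2 R) `<=` T @` unit_ball X
       & opnorm T = d2 X]) /\
  (forall T : {linear X -> euclidean2 R},
     PD e T ->
     unit_ball (euclidean2 R) `<=` T @` unit_ball X ->
     (opnorm T = d2 X <->
      exists x1 x2 y1 y2 : X,
        [/\ unit_sphere X x1, unit_sphere X x2, x1 <> x2 & x1 <> - x2] /\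
        [/\ unit_sphere X y1, unit_sphere X y2, y1 <> y2 & y1 <> - y2] /\
        [/\ `|T x1| = opnorm T, `|T x2| = opnorm T,
            `|T y1| = 1 & `|T y2| = 1] /\
        cone x1 x2 y1 /\ cone (- x1) x2 y2)).
Proof.
have gN := coord_norm_gauge he.
have [c [M opt]] := optimal_exists gN; have [sw le_M] := opt.
have dE := optimal_d2 he opt.
have M1 := sandwich_ge1 gN sw.
have d0 : 0 <= d2 X by rewrite dE sqrtr_ge0.
have d2E : d2 X ^+ 2 = M by rewrite dE sqr_sqrtr//; lra.
have op0 (T : {linear X -> euclidean2 R}) : 0 <= opnorm T.
  by have [C HC] := map_bounded he T; exact: opnorm_ge0 (e0_neq0 he) HC.
have swT (T : {linear X -> euclidean2 R}) :
    PD e T -> unit_ball (euclidean2 R) `<=` T @` unit_ball X ->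
    sandwich (coord_norm e) (map_form e T) (opnorm T ^+ 2).
  move=> TPD /(unit_ball_imageP he TPD) Tlo; apply/(map_sandwichP he _ (op0 T)) => x.
  by have [C HC] := map_bounded he T; rewrite Tlo; exact: opnorm_bound HC _.
have [x1 [x2 [y1 [y2 alt]]]] := optimal_interlaced gN opt.
split.
  have [T [TPD TE]] : exists T, PD e T /\ map_form e T = c.
    apply: (PD_with_form he) => v v0.
    by have /andP[+ _] := sw v; apply: lt_le_trans; exact: gauge_sqr_gt0.
  have Tb : forall x, `|x| <= `|T x| <= d2 X * `|x|.
    by apply/(map_sandwichP he _ d0); rewrite TE d2E.
  have Tball : unit_ball (euclidean2 R) `<=` T @` unit_ball X.
    by apply/(unit_ball_imageP he TPD) => x; have /andP[] := Tb x.
  exists T; split=> [|T' [T'PD T'ball T'd]].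
    split=> //; apply/eqP; rewrite eq_le; apply/andP; split.
      by apply: opnorm_le (e0_neq0 he) _ => x; have /andP[] := Tb x.
    by rewrite -ler_sqr ?nnegrE// d2E (le_M _ _ (swT _ TPD Tball)).
  apply: (PD_map_form_inj he) => //; rewrite TE; apply/esym.
  apply: (interlaced_unique gN sw alt).
  by rewrite -d2E -T'd; exact: swT.
move=> T TPD Tball; have swT' := swT T TPD Tball.
apply: iff_trans (interlaced_of_coord he T (op0 T)); split.
  move=> Td; apply: (optimal_interlaced gN); split=> //.
  by rewrite Td d2E.
move=> [u1 [u2 [v1 [v2 altT]]]]; apply/eqP; rewrite -(eqrXn2 (n := 2))//.
by rewrite eq_le d2E (le_M _ _ swT') andbT (interlaced_le gN altT sw).
Qed.
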